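(* Let $n\in\mathbb{N}$, let $\delta$ be a positive infinitesimal in ${}^*\mathbb{R}$ and let $\tau=\tau^\delta$. Then $(\mathcal{G},\tau)$ is a Hausdorff topological ring.
   Context: A sufficiently saturated nonstandard extension $X\mapsto{}^*X$ (at least an enlargement) is fixed. $\mathcal{G}=\mathcal{G}_{n,1}$ is the ring of germs at $0$ of functions $f:(\mathbb{R}^n,0)\to(\mathbb{R},0)$ (defined on a neighborhood of $0$, $f(0)=0$) under pointwise operations. For real $r>0$, $\|f\|_r=\sup\{|f(x)|:|x|\le r\}$, and ${}^*\|f\|_\delta$ is the value at $\delta$ of the transfer of $r\mapsto\|f\|_r$, i.e. the internal supremum of $|{}^*f|$ on $B_\delta=\{\xi\in{}^*\mathbb{R}^n:|\xi|\le\delta\}$. $\mathcal{M}$ is the set of germs at $0$ of functions $m:\mathbb{R}_+\to\mathbb{R}_+$ with $\lim_{t\to0}m(t)=0$ and $m(r)<m(t)$ for all sufficiently small $0<r<t$. $\mathcal{N}_\delta=\{{}^*m(\delta):[m]\in\mathcal{M}\}$. For $\mathfrak r\in\mathcal{N}_\delta$, $U^\delta_{\mathfrak r}=\{[f]\in\mathcal{G}:{}^*\|f\|_\delta<\mathfrak r\}$. $\tau^\delta$ is the topology on $\mathcal{G}$ generated by the subbase of all translates $U^\delta_{\mathfrak r}+[f]$, $\mathfrak r\in\mathcal{N}_\delta$, $[f]\in\mathcal{G}$.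
   Formalization: Multiplication is asserted continuous only at pairs of germs with finite ‖f‖_r for small r (shown to form a subring); on all of G it fails, e.g. for f(p/q)=q, f=0 elsewhere. Hausdorffness, ring axioms and continuity of + and − are asserted on all of G. *)

(* Defs.v *)
From HB Require Import structures.
From mathcomp Require Import all_boot all_order all_algebra.
From mathcomp Require Import generic_quotient ring_quotient.
From mathcomp Require Import all_classical all_reals all_analysis.
Set Implicit Arguments.
Unset Strict Implicit.
Unset Printing Implicit Defensive.
Import Order.TTheory GRing.Theory Num.Theory numFieldNormedType.Exports.
Local Open Scope classical_set_scope.
Local Open Scope ring_scope.

(** The standard universe is Robinson's structure of finite types over the
    individuals [R] and [\bar R]: it is closed under products, function spaces
    and power sets.  The transfer principle is stated for the typed first-order
    language having every standard object as a constant.  Since function spaces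
    and power sets are themselves sorts, quantifiers over them range, in the
    extension, over the internal functions and sets. *)

Inductive sort : Type :=
| Real
| EReal
| Prod of sort & sort
| Arrow of sort & sort
| Pow of sort.

Fixpoint std (R : realType) (s : sort) : Type :=
  match s with
  | Real => R
  | EReal => \bar R
  | Prod s1 s2 => (std R s1 * std R s2)%type
  | Arrow s1 s2 => std R s1 -> std R s2
  | Pow s1 => set (std R s1)
  end.

Record type_structure := TypeStructure {
  carrier :> sort -> Type;
  ipair : forall s t, carrier s -> carrier t -> carrier (Prod s t);
  iapp : forall s t, carrier (Arrow s t) -> carrier s -> carrier t;
  imem : forall s, carrier s -> carrier (Pow s) -> Prop
}.
Arguments ipair {_ s t}.
Arguments iapp {_ s t}.
Arguments imem {_ s}.

Definition standard (R : realType) : type_structure :=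
  {| carrier := std R;
     ipair := fun _ _ x y => (x, y);
     iapp := fun _ _ f x => f x;
     imem := fun _ x A => A x |}.

(* Well-sorted de Bruijn variables, terms and formulas in a context of sorts. *)
Inductive var : seq sort -> sort -> Type :=
| VarO G s : var (s :: G) s
| VarS G s t : var G s -> var (t :: G) s.

Inductive term (R : realType) (G : seq sort) : sort -> Type :=
| Var s of var G s : term R G s
| Cst s of std R s : term R G s
| TPair s t of term R G s & term R G t : term R G (Prod s t)
| TApp s t of term R G (Arrow s t) & term R G s : term R G t.

Inductive formula (R : realType) : seq sort -> Type :=
| FEq G s of term R G s & term R G s : formula R G
| FMem G s of term R G s & term R G (Pow s) : formula R G
| FNot G of formula R G : formula R G
| FAnd G of formula R G & formula R G : formula R G
| FAll G s of formula R (s :: G) : formula R G.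

Section semantics.
Context (R : realType) (M : type_structure) (c : forall s, std R s -> M s).

Fixpoint env (G : seq sort) : Type :=
  if G is s :: G' then (M s * env G')%type else unit.

Fixpoint lookup G s (v : var G s) : env G -> M s :=
  match v with
  | VarO _ _ => fun e => e.1
  | VarS _ _ _ v' => fun e => lookup v' e.2
  end.

Fixpoint eval G s (t : term R G s) (e : env G) : M s :=
  match t with
  | Var _ v => lookup v e
  | Cst _ x => c x
  | TPair _ _ t1 t2 => ipair (eval t1 e) (eval t2 e)
  | TApp _ _ t1 t2 => iapp (eval t1 e) (eval t2 e)
  end.

Fixpoint holds G (phi : formula R G) : env G -> Prop :=
  match phi with
  | FEq _ _ t1 t2 => fun e => eval t1 e = eval t2 e
  | FMem _ _ t1 t2 => fun e => imem (eval t1 e) (eval t2 e)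
  | FNot _ p => fun e => ~ holds p e
  | FAnd _ p q => fun e => holds p e /\ holds q e
  | FAll _ _ p => fun e => forall x, holds p (x, e)
  end.

End semantics.

(* [star x] is the extension *x of a standard object [x]. *)
Record nonstandard_extension (R : realType) := NonstandardExtension {
  nsu :> type_structure;
  star : forall s, std R s -> nsu s;
  transfer : forall phi : formula R [::],
    holds (M := standard R) (fun _ x => x) phi tt <-> holds star phi tt;
  enlargement : forall (s : sort) (F : set (std R (Pow s))),
    (forall B : set (std R (Pow s)), finite_set B -> B `<=` F ->
       \bigcap_(A in B) (A : set (std R s)) !=set0) ->
    exists x : nsu s, forall A, F A -> imem x (star A)
}.
Arguments star {R} n s.

Section hyperreals.
Context (R : realType) (E : nonstandard_extension R).

Definition hyperreal : Type := E Real.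
Definition hyperereal : Type := E EReal.

Definition real_star (x : R) : hyperreal := star E Real x.

(* The value at [xi] of the extension of a standard function. *)
Definition star_fun (f : R -> R) (xi : hyperreal) : hyperreal :=
  iapp (star E (Arrow Real Real) f) xi.

Definition star_efun (f : R -> \bar R) (xi : hyperreal) : hyperereal :=
  iapp (star E (Arrow Real EReal) f) xi.

Definition hyper_EFin (xi : hyperreal) : hyperereal := star_efun EFin xi.

Definition hyper_lt (xi eta : hyperreal) : Prop :=
  imem (ipair xi eta)
    (star E (Pow (Prod Real Real)) [set p : R * R | p.1 < p.2]).

Definition hyper_elt (xi eta : hyperereal) : Prop :=
  imem (ipair xi eta)
    (star E (Pow (Prod EReal EReal)) [set p : \bar R * \bar R | (p.1 < p.2)%E]).

Definition positive_infinitesimal (delta : hyperreal) : Prop :=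
  hyper_lt (real_star 0) delta /\
  forall e : R, 0 < e -> hyper_lt delta (real_star e).

End hyperreals.

(* Mathcomp-Analysis norms ['rV[R]_n] by the maximum norm. *)
Definition enorm (R : realType) (n : nat) (x : 'rV[R]_n) : R :=
  Num.sqrt (\sum_i x ord0 i ^+ 2).

(* Functions (R^n, 0) -> (R, 0).  They are total: a function defined only near
   0 has the same germ as any of its extensions. *)
Section pointed_functions.
Context (R : realType) (n : nat).

Definition vanishes_at0 : {pred ('rV[R]_n -> R)} := fun f => f 0 == 0.

Lemma vanishes_at0_zmod_closed : zmod_closed vanishes_at0.
Proof.
split=> [|f g]; rewrite !unfold_in /vanishes_at0 //= => /eqP f0 /eqP g0.
by rewrite !fctE f0 g0 subr0.
Qed.

HB.instance Definition _ :=
  GRing.isZmodClosed.Build ('rV[R]_n -> R) vanishes_at0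
    vanishes_at0_zmod_closed.

Record pfun := PFun { pfun_val :> 'rV[R]_n -> R; _ : pfun_val \in vanishes_at0 }.

HB.instance Definition _ := [isSub for pfun_val].
HB.instance Definition _ := [Choice of pfun by <:].
HB.instance Definition _ := [SubChoice_isSubZmodule of pfun by <:].

Lemma pfun0 (f : pfun) : f 0 = 0.
Proof. by case: f => f /= /eqP. Qed.

Lemma pfunB (f g : pfun) x : (f - g) x = f x - g x.
Proof. by rewrite -[pfun_val _]/(val (f - g)) GRing.valB. Qed.

Lemma pfun_mul_subproof (f g : pfun) : (f \* g) \in vanishes_at0.
Proof. by rewrite unfold_in /vanishes_at0 /= !pfun0 mulr0. Qed.

Definition pfun_mul (f g : pfun) : pfun := PFun (pfun_mul_subproof f g).

Definition null_germ : {pred pfun} :=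
  fun f => `[< \forall x \near (0 : 'rV[R]_n), f x = 0 >].

Lemma null_germ_zmod_closed : zmod_closed null_germ.
Proof.
split=> [|f g]; rewrite !unfold_in /null_germ.
  by apply/asboolP; near=> x.
move=> /asboolP f0 /asboolP g0; apply/asboolP.
by apply: filterS2 f0 g0 => x fx gx; rewrite pfunB fx gx subr0.
Unshelve. all: by end_near. Qed.

HB.instance Definition _ :=
  GRing.isZmodClosed.Build pfun null_germ null_germ_zmod_closed.

End pointed_functions.

Section germs.
Local Open Scope quotient_scope.
Context (R : realType) (n : nat).

Definition germ : Type := Quotient.quot (@null_germ R n).

HB.instance Definition _ := GRing.Zmodule.on germ.

Definition germ_of (f : pfun R n) : germ := \pi f.

Definition germ_mul (a b : germ) : germ := germ_of (pfun_mul (repr a) (repr b)).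

Lemma germ_of_eq (f g : pfun R n) :
  germ_of f = germ_of g <-> \forall x \near (0 : 'rV[R]_n), f x = g x.
Proof.
have E : germ_of f = germ_of g <-> (f - g) \in @null_germ R n.
  by rewrite Quotient.idealrBE; split=> /eqP.
rewrite E unfold_in; split=> [/asboolP|] fg; last apply/asboolP.
  by apply: filterS fg => x /eqP; rewrite pfunB subr_eq0 => /eqP.
by apply: filterS fg => x fgx; rewrite pfunB fgx subrr.
Qed.

Lemma germ_ofD (f g : pfun R n) : germ_of (f + g) = germ_of f + germ_of g.
Proof. by rewrite /germ_of !piE. Qed.

Lemma germ_ofN (f : pfun R n) : germ_of (- f) = - germ_of f.
Proof. by rewrite /germ_of !piE. Qed.

Lemma germ_ofM (f g : pfun R n) :
  germ_of (pfun_mul f g) = germ_mul (germ_of f) (germ_of g).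
Proof.
have reprP h : \forall x \near (0 : 'rV[R]_n), repr (germ_of h) x = h x.
  by apply/germ_of_eq; rewrite /germ_of reprK.
apply/germ_of_eq; apply: filterS2 (reprP f) (reprP g) => x fx gx.
by rewrite /= fx gx.
Qed.

End germs.

(* ||f||_r; it is +oo when f is unbounded on the ball of radius r. *)
Definition gnorm (R : realType) (n : nat) (f : 'rV[R]_n -> R) (r : R) : \bar R :=
  ereal_sup [set `|f x|%:E | x in [set x | enorm x <= r]].

(* The germs with a finite norm ||f||_r for small r.  Multiplication by a germ
   that is unbounded on every open set, such as q at p/q and 0 elsewhere, need
   not be continuous for the topology below. *)
Definition locally_bounded (R : realType) (n : nat) : set (germ R n) :=
  [set germ_of f | f in
    [set f : pfun R n | exists2 r, 0 < r & (gnorm f r < +oo)%E]].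

(* Representatives of the germs in M; their values off ]0, +oo[ are irrelevant. *)
Definition moduli (R : realType) : set (R -> R) :=
  [set m | [/\ forall t, 0 < t -> 0 < m t,
               m t @[t --> 0^'+] --> (0 : R) &
               exists2 e, 0 < e & forall r t, 0 < r -> r < t -> t < e -> m r < m t]].

Section topology.
Context (R : realType) (n : nat) (E : nonstandard_extension R).
Context (delta : hyperreal E).

Definition Ndelta : set (hyperreal E) :=
  [set star_fun m delta | m in @moduli R].

Definition Udelta (r : hyperreal E) : set (germ R n) :=
  [set germ_of f | f in
    [set f : pfun R n | hyper_elt (star_efun (gnorm f) delta) (hyper_EFin r)]].

Definition translate (U : set (germ R n)) (a : germ R n) : set (germ R n) :=
  [set u + a | u in U].

Definition tau_subbase : set (set (germ R n)) :=
  [set V | exists r a, Ndelta r /\ V = translate (Udelta r) a].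

End topology.

Definition tau_germ (R : realType) (n : nat) (E : nonstandard_extension R)
  (delta : hyperreal E) : Type := germ R n.

HB.instance Definition _ R n E delta :=
  GRing.Zmodule.on (@tau_germ R n E delta).
HB.instance Definition _ R n E delta :=
  @isSubBaseTopological.Build (@tau_germ R n E delta)
    (set (germ R n)) (@tau_subbase R n E delta) id.

(* Rings are commutative and without unit (germs vanish at 0).  For [B = setT] this is the usual notion of
   a (commutative) topological ring; in general, [T] is a ring and a topological
   additive group, and [B] is a subring at whose points the product of [T] is
   continuous, so that [B] is a topological ring. *)
Record topological_ring_on (T : PreTopologicalZmodule.type) (mul : T -> T -> T)
    (B : set T) : Prop := TopologicalRingOn {
  trng_mulA : associative mul;
  trng_mulC : commutative mul;
  trng_mulDl : left_distributive mul +%R;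
  trng_add_continuous : continuous (fun p : T * T => p.1 + p.2);
  trng_opp_continuous : continuous (fun a : T => - a);
  trng_sub0 : B 0;
  trng_subB : forall a b, B a -> B b -> B (a - b);
  trng_subM : forall a b, B a -> B b -> B (mul a b);
  trng_mul_continuous : forall a b, B a -> B b ->
    {for (a, b), continuous (fun p : T * T => mul p.1 p.2)}
}.

(* Main.v *)
Require Import Defs.
From HB Require Import structures.
From mathcomp Require Import all_boot all_order all_algebra.
From mathcomp Require Import all_classical all_reals all_analysis.
From mathcomp Require Import finmap ring lra.
Import Order.TTheory GRing.Theory Num.Theory numFieldNormedType.Exports.
Local Open Scope classical_set_scope.
Local Open Scope ring_scope.

Set Implicit Arguments.
Unset Strict Implicit.

(** The sets of reals whose extension contains [delta] form a proper filter on
    [R] containing every [0 < t < e], and by transfer a strict inequality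
    between the values at [delta] of two standard functions holds exactly when
    it holds for the reals of a set in this filter.  So the topology has a
    standard description: a subbasic set, called a tube below, consists of the
    germs [f] with [|| f - a ||_t < m t] for all [t] in a set of the filter,
    where [a] is its centre and the modulus [m] its width.

    The space is Hausdorff because [t * min (1, || h ||_t)] is a modulus below
    [|| h ||_t] when the germ [h] is not null: half of it is the width of
    disjoint tubes centred at two germs with difference [h].

    Continuity of the operations is less direct.  If a tube of width [m]
    contains [f], at distance [e = f - a] from its centre, then [m - || e ||] is
    positive at [delta], but there may be no modulus below it, so the tubes
    centred at [f] need not form a base of its neighbourhoods.  Tubes centred
    elsewhere repair this.  The tubes of width [m / k] centred at [f + e / k]
    and [f - e / k] both contain [f], and [g] lies in both exactly when
    [k |g - f| + |e| < m] uniformly on the ball: the intersection keeps [g]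
    within the gap [m - |e|] at every point ([nbhs_twin_tube]).  The increments
    [u], [v] of the arguments of an operation are thus controlled pointwise.
    For the sum, take [k = 2]; for the product at germs bounded by [M], take
    [k = 3 M], since then [|u| <= M] and
    [|u v + f v + u g + e| <= M |v| + M |v| + M |u| + |e| < m]. *)

(** * The filter of sets containing a hyperreal *)

Section trace.
Context (R : realType) (E : nonstandard_extension R) (delta : hyperreal E).

Definition trace : set_system R :=
  [set A | imem delta (star E (Pow Defs.Real) A)].

(** Transfer of universally quantified implications: it yields both the filter
    laws and the translation of inequalities at [delta]. *)
Lemma transfer_imply (phi psi : formula R [:: Defs.Real]) :
  (forall t : R, holds (M := standard R) (fun _ x => x) phi (t, tt) ->
    holds (M := standard R) (fun _ x => x) psi (t, tt)) ->
  forall xi : E Defs.Real,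
    holds (star E) phi (xi, tt) -> holds (star E) psi (xi, tt).
Proof.
move=> imp xi Hphi; apply: contrapT => Hpsi.
have /(transfer E) /= /(_ xi) H : holds (M := standard R) (fun _ x => x)
    (FAll (FNot (FAnd phi (FNot psi)))) tt.
  by move=> t /= [] /imp.
by apply: H.
Qed.

Lemma trace_filter : Filter trace.
Proof.
pose x0 := Var R (VarO [::] Defs.Real).
pose inT A := FMem x0 (Cst [:: Defs.Real] (s := Pow Defs.Real) A).
split; first exact: (@transfer_imply (FEq x0 x0) (inT setT)).
  move=> A B DA DB.
  exact: (@transfer_imply (FAnd (inT A) (inT B)) (inT (A `&` B))).
move=> A B AB; exact: (@transfer_imply (inT A) (inT B)).
Qed.

Lemma trace_proper : ProperFilter trace.
Proof.
have D := trace_filter; split => //.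
pose x0 := Var R (VarO [::] Defs.Real).
move=> D0.
have := @transfer_imply (FMem x0 (Cst [:: Defs.Real] (s := Pow Defs.Real) set0))
  (FNot (FEq x0 x0)) _ delta D0.
by apply.
Qed.

(** That [delta] is a positive infinitesimal enters through this alone. *)
Lemma trace_near0 (hdelta : positive_infinitesimal delta) (e : R) : 0 < e ->
  \forall t \near trace, 0 < t < e.
Proof.
have D := trace_filter.
case: hdelta => d0 dlt e0.
pose x0 := Var R (VarO [::] Defs.Real).
pose LT := Cst [:: Defs.Real] (s := Pow (Prod Defs.Real Defs.Real))
  [set p : R * R | p.1 < p.2].
pose inT A := FMem x0 (Cst [:: Defs.Real] (s := Pow Defs.Real) A).
pose c0 (x : R) := Cst [:: Defs.Real] (s := Defs.Real) x.
have H1 : trace [set t | 0 < t].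
  exact: (@transfer_imply (FMem (TPair (c0 0) x0) LT) (inT [set t | 0 < t])).
have H2 : trace [set t | t < e].
  by apply: (@transfer_imply (FMem (TPair x0 (c0 e)) LT) (inT [set t | t < e]))
    => //; exact: dlt.
by apply: filterS2 H1 H2 => t /= -> ->.
Qed.

Lemma hyper_elt_trace (F : R -> \bar R) (m : R -> R) :
  hyper_elt (star_efun F delta) (hyper_EFin (star_fun m delta)) <->
  \forall t \near trace, (F t < (m t)%:E)%E.
Proof.
pose x0 := Var R (VarO [::] Defs.Real).
pose LT := Cst [:: Defs.Real] (s := Pow (Prod EReal EReal))
  [set p : \bar R * \bar R | (p.1 < p.2)%E].
pose lt := FMem (TPair (TApp (Cst _ (s := Arrow Defs.Real EReal) F) x0)
  (TApp (Cst _ (s := Arrow Defs.Real EReal) EFin)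
    (TApp (Cst _ (s := Arrow Defs.Real Defs.Real) m) x0))) LT.
pose inT := FMem x0 (Cst [:: Defs.Real] (s := Pow Defs.Real)
  [set t | (F t < (m t)%:E)%E]).
by split; [apply: (@transfer_imply lt inT)|apply: (@transfer_imply inT lt)].
Qed.

End trace.

(** * Suprema over Euclidean balls, germs *)

Section seminorm.
Context (R : realType) (n : nat).
Implicit Types (h : 'rV[R]_n -> R) (x : 'rV[R]_n).

(** The bound [c' < c] keeps the uniformity that a strict pointwise inequality
    loses. *)
Lemma gnorm_ltP h (t c : R) : (Defs.gnorm h t < c%:E)%E <->
  exists2 c', c' < c & forall x, enorm x <= t -> `|h x| <= c'.
Proof.
split; last first.
  move=> [c' c'c hc']; apply: (@le_lt_trans _ _ c'%:E); last by rewrite lte_fin.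
  by apply: ge_ereal_sup => _ [x /= /hc' xc' <-]; rewrite lee_fin.
have ub x : enorm x <= t -> (`|h x|%:E <= Defs.gnorm h t)%E.
  by move=> xt; apply: ereal_sup_ubound; exists x.
case: (Defs.gnorm h t) ub => [r| |] ub; rewrite ?lte_fin //.
  by move=> rc; exists r => // x /ub; rewrite lee_fin.
move=> _; exists (c - 1); first by rewrite ltrBlDr ltrDl.
by move=> x /ub; rewrite leeNy_eq.
Qed.

(** Germs are defined with the neighbourhoods of the maximum norm; [x] has
    Euclidean norm at most [r] as soon as its entries are at most [r / (n + 1)],
    a radius that makes sense also for [n = 0]. *)
Lemma near0_enormP (P : set 'rV[R]_n) :
  (\forall x \near (0 : 'rV[R]_n), P x) <->
  exists2 r, 0 < r & forall x, enorm x <= r -> P x.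
Proof.
split=> [/nbhs_ballP [e /= e0 eP]|[r r0 rP]].
  exists (e / 2); first by rewrite divr_gt0.
  move=> x xe; apply: eP; split => // i j.
  rewrite (ord1 i) mxE /ball /= sub0r normrN.
  rewrite (@le_lt_trans _ _ (enorm x)) //; last first.
    by rewrite (le_lt_trans xe)// ltr_pdivrMr// ltr_pMr// ltr1n.
  rewrite -sqrtr_sqr ler_wsqrtr// (bigD1 j)//= lerDl sumr_ge0// => k _.
  exact: sqr_ge0.
apply/nbhs_ballP; exists (r / n.+1%:R) => /=; first by rewrite divr_gt0.
move=> x [_ xr]; apply: rP.
rewrite -(ger0_norm (ltW r0)) -sqrtr_sqr ler_wsqrtr//.
apply: (@le_trans _ _ (\sum_(i < n) (r / n.+1%:R) ^+ 2)).
  apply: ler_sum => i _; have := xr ord0 i.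
  rewrite mxE /ball /= sub0r normrN => /ltW xi.
  by rewrite -(real_normK (num_real _)) lerXn2r // nnegrE // divr_ge0 // ltW.
rewrite sumr_const card_ord expr_div_n -[_ *+ n]mulr_natr -mulrA.
rewrite ler_piMr ?sqr_ge0//.
rewrite mulrC ler_pdivrMr ?exprn_gt0// mul1r -natrX ler_nat.
by rewrite expnS expn1 (leq_trans (leqnSn n))// leq_pmulr.
Qed.

Lemma pfunD (f g : pfun R n) x : (f + g) x = f x + g x.
Proof. by rewrite -[pfun_val _]/(val (f + g)) GRing.valD. Qed.

Lemma pfunN (f : pfun R n) x : (- f) x = - f x.
Proof. by rewrite -[pfun_val _]/(val (- f)) GRing.valN. Qed.

Lemma pfun_scale_subproof (k : R) (f : pfun R n) :
  (fun x => k * f x) \in @vanishes_at0 R n.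
Proof. by rewrite unfold_in /vanishes_at0 pfun0 mulr0. Qed.

Definition pfun_scale (k : R) (f : pfun R n) : pfun R n :=
  PFun (pfun_scale_subproof k f).

Lemma germ_of0 : germ_of (0 : pfun R n) = 0.
Proof. by rewrite -(subrr (0 : pfun R n)) germ_ofD germ_ofN subrr. Qed.

Lemma germ_of_surj (a : germ R n) : exists f, germ_of f = a.
Proof. by exists (repr a); rewrite /germ_of reprK. Qed.

End seminorm.

(** * Moduli *)

Section moduli.
Context (R : realType) (n : nat).

Lemma moduli_scale (k : R) (m : R -> R) : 0 < k -> @moduli R m ->
  @moduli R (fun t => k * m t).
Proof.
move=> k0 [m0 mlim [e e0 mincr]]; split=> [t /m0 ?||]; first exact: mulr_gt0.
  by rewrite -[X in _ --> X](mulr0 k); apply: cvgM mlim; exact: cvg_cst.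
by exists e => // r t r0 rt te; rewrite ltr_pM2l//; exact: mincr.
Qed.

(** The factor [t] makes a monotone function strictly increasing, and the
    truncation at 1 makes the product tend to 0. *)
Lemma moduli_minorant (F : R -> R) :
  (forall t, 0 < t -> 0 < F t) ->
  (forall r t, 0 < r -> r < t -> F r <= F t) ->
  @moduli R (fun t => t * Num.min 1 (F t)).
Proof.
move=> F0 Fincr; split.
- by move=> t t0; rewrite mulr_gt0// lt_min ltr01 F0.
- apply/cvgrPdist_lt => e e0; near=> t.
  have t0 : 0 < t by near: t; exact: nbhs_right_gt.
  have te : t < e by near: t; exact: nbhs_right_lt.
  have m0 : 0 <= Num.min 1 (F t) by rewrite le_min ler01 ltW// F0.
  rewrite sub0r normrN ger0_norm; last by rewrite mulr_ge0// ltW.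
  by rewrite (le_lt_trans _ te)// ler_piMr ?(ltW t0)// ge_min lexx.
- exists 1 => // r t r0 rt _.
  have t0 := lt_trans r0 rt.
  apply: (@lt_le_trans _ _ (t * Num.min 1 (F r))).
    by rewrite ltr_pM2r// lt_min ltr01 F0.
  rewrite ler_pM2l// le_min ge_min lexx/= ge_min.
  by rewrite (Fincr _ _ r0 rt) orbT.
Unshelve. all: by end_near. Qed.

(** A nonzero germ is not infinitely small at the scale of the moduli; this is
    what separates points. *)
Lemma moduli_le_gnorm (h : pfun R n) : germ_of h <> 0 ->
  exists2 m, @moduli R m &
    forall t, 0 < t -> t < 1 -> ((m t)%:E <= Defs.gnorm h t)%E.
Proof.
move=> h0; pose F t := fine (Order.min 1%E (Defs.gnorm h t)).
have hpos t : 0 < t -> (0 < Defs.gnorm h t)%E.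
  move=> t0; rewrite ltNge; apply/negP => ht; apply: h0.
  rewrite -germ_of0; apply/germ_of_eq/near0_enormP; exists t => // x xt.
  rewrite -(subrr (0 : pfun R n)) pfunB subrr; apply/eqP; rewrite -normr_le0.
  rewrite -lee_fin; apply: le_trans ht; apply: ereal_sup_ubound.
  by exists x.
have Ffin t : 0 < t -> (F t)%:E = Order.min 1%E (Defs.gnorm h t).
  move=> t0; rewrite fineK// fin_numElt (@lt_le_trans _ _ 0%E)//=.
    by rewrite gt_min ltry.
  by rewrite le_min lee01 ltW// hpos.
(* F takes the minimum with 1 to be real where the norm is infinite. *)
exists (fun t => t * Num.min 1 (F t)).
  apply: moduli_minorant => [t t0|r t r0 rt].
    by rewrite -lte_fin Ffin// lt_min lte01 hpos.
  rewrite -lee_fin !Ffin// ?(lt_trans r0)// le_min ge_min lexx /= ge_min.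
  apply/orP; right; apply: ereal_sup_le => _ [x /= xr <-].
  by exists x => //=; rewrite (le_trans xr) ?ltW.
move=> t t0 t1; apply: (@le_trans _ _ (F t)%:E); last first.
  by rewrite Ffin// ge_min lexx orbT.
have F0 : 0 <= F t by rewrite -lee_fin Ffin// le_min lee01 ltW// hpos.
rewrite lee_fin (@le_trans _ _ (Num.min 1 (F t)))//; last first.
  by rewrite ge_min lexx orbT.
by rewrite ler_piMl ?(ltW t1)// le_min ler01.
Qed.

End moduli.

(** * Tubes *)

Section tubes.
Context (R : realType) (n : nat) (E : nonstandard_extension R).
Context (delta : hyperreal E) (hdelta : positive_infinitesimal delta).
Local Notation T := (tau_germ n delta).
Local Notation D := (trace delta).
Let D_proper : ProperFilter D := trace_proper delta.
#[local] Existing Instance D_proper.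

Definition small (h : 'rV[R]_n -> R) (m : R -> R) : Prop :=
  \forall t \near D, (Defs.gnorm h t < (m t)%:E)%E.

Lemma sub_small (h h' : 'rV[R]_n -> R) m :
  (\forall t \near D, forall x, enorm x <= t -> `|h' x| <= `|h x|) ->
  small h m -> small h' m.
Proof.
move=> le sm; apply: filterS2 le sm => t le /gnorm_ltP [c cm hc].
by apply/gnorm_ltP; exists c => // x xt; rewrite (le_trans (le _ xt)) ?hc.
Qed.

Lemma trace_germ_eq (f g : pfun R n) : germ_of f = germ_of g ->
  \forall t \near D, forall x, enorm x <= t -> f x = g x.
Proof.
move=> /germ_of_eq /near0_enormP [r r0 fg].
apply: filterS (trace_near0 hdelta r0) => t /andP[_ tr] x xt.
by apply: fg; rewrite (le_trans xt) ?ltW.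
Qed.

Definition tube (a : pfun R n) (m : R -> R) : set T :=
  translate (Udelta delta (star_fun m delta)) (germ_of a).

(** Membership does not depend on the representatives: functions with the same
    germ have the same norms on balls of small radius. *)
Lemma tubeP (a f : pfun R n) m :
  tube a m (germ_of f) <-> small (fun x => f x - a x) m.
Proof.
split=> [[_ [h hm <-]]|fam]; last first.
  exists (germ_of (f - a)); last by rewrite -germ_ofD subrK.
  exists (f - a) => //; apply/hyper_elt_trace.
  rewrite (_ : pfun_val _ = fun x => f x - a x) //;
  by apply/funext => x; rewrite pfunB.
rewrite -germ_ofD => /trace_germ_eq eq; move/hyper_elt_trace: hm.
apply: sub_small; apply: filterS eq => t eq x /eq <-.
by rewrite pfunD addrK.
Qed.

Lemma open_tube (a : pfun R n) m : @moduli R m -> open (tube a m : set T).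
Proof.
move=> mm; exists [set tube a m]; last by rewrite bigcup_set1.
move=> _ ->; exists [fset (tube a m : set (germ R n))]%fset.
  move=> V; rewrite in_fset1 => /eqP ->; apply: mem_set.
  by exists (star_fun m delta), (germ_of a); split => //; exists m.
by rewrite set_fset1 bigcap_set1.
Qed.

(** Finite intersections of tubes form a base, so that convergence is tested on
    the tubes around the limit. *)
Lemma cvg_tube (F : set_system T) (f : pfun R n) : Filter F ->
  (forall a m, @moduli R m -> tube a m (germ_of f) -> F (tube a m)) ->
  F --> (germ_of f : T).
Proof.
move=> FF Ftube A; rewrite nbhsE => -[_ [[B sB <-] [C BC Cf]] sBA].
rewrite nbhs_filterE; apply: filterS sBA _; apply: (@filterS _ _ _ C).
  by move=> y Cy; exists C.
have [S sS IS] := sB _ BC; rewrite -IS; apply: filter_bigI => V VS.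
have /set_mem [_ [a [[m mm <-] VE]]] := sS _ VS.
have [a' aE] := germ_of_surj a.
have -> : id V = tube a' m by rewrite /tube aE.
by apply: Ftube => //; rewrite /tube aE -VE; move: Cf; rewrite -IS; apply.
Qed.

Definition twin_tube (f e : pfun R n) (k : R) (m : R -> R) : set T :=
  [set c | forall g, germ_of g = c ->
    small (fun x => k * `|g x - f x| + `|e x|) m].

(** [twin_tube f e k m] contains the intersection of the tubes of width [m / k]
    centred at [f - e / k] and [f + e / k], because [|w + z|] and [|w - z|] are
    both below [c] only if [|w| + |z|] is. *)
Lemma nbhs_twin_tube (f e : pfun R n) k m : 0 < k -> @moduli R m -> small e m ->
  nbhs (germ_of f : T) (twin_tube f e k m).
Proof.
move=> k0 mm em; pose m' t := k^-1 * m t.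
have mm' : @moduli R m' by apply: moduli_scale => //; rewrite invr_gt0.
have tubef s : `|s| = k^-1 ->
    nbhs (germ_of f : T) (tube (f - pfun_scale s e) m').
  move=> sk; apply: open_nbhs_nbhs; split; first exact: open_tube.
  apply/tubeP; apply: filterS em => t /gnorm_ltP [c cm ec].
  apply/gnorm_ltP; exists (k^-1 * c); first by rewrite ltr_pM2l ?invr_gt0.
  move=> x /ec exc; rewrite pfunB subKr /= normrM sk.
  by rewrite ler_pM2l ?invr_gt0.
have kV : `|k^-1| = k^-1 by rewrite ger0_norm// invr_ge0 ltW.
have kVN : `|- k^-1| = k^-1 by rewrite normrN.
apply: filterS2 (tubef _ kV) (tubef _ kVN) => c + + g gE.
rewrite -gE => /tubeP gp /tubeP gm.
apply: filterS2 gp gm => t /gnorm_ltP [c1 c1m gc1] /gnorm_ltP [c2 c2m gc2].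
apply/gnorm_ltP; exists (k * Num.max c1 c2).
  by rewrite -ltr_pdivlMl// gt_max c1m c2m.
move=> x xt; have := gc1 x xt; have := gc2 x xt.
rewrite !pfunB /= => h2 h1.
rewrite ger0_norm; last by rewrite addr_ge0// mulr_ge0// ltW.
rewrite -ler_pdivrMl//.
have -> : k^-1 * (k * `|g x - f x| + `|e x|) = `|g x - f x| + `|k^-1 * e x|.
  by rewrite mulrDr mulKf ?gt_eqF// normrM kV.
move: h1 h2; rewrite !ler_norml; set w := k^-1 * e x.
rewrite mulNr -/w => h1 h2.
have : c1 <= Num.max c1 c2 by rewrite le_max lexx.
have : c2 <= Num.max c1 c2 by rewrite le_max lexx orbT.
by case: (ger0P (g x - f x)); case: (ger0P w); lra.
Qed.

End tubes.

Arguments tube {R n E} delta a m _.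
Arguments twin_tube {R n E} delta f e k m _.

(** * The ring of germs and its locally bounded elements *)

Section locally_bounded_germs.
Context (R : realType) (n : nat).

Lemma gnorm_ltyP (h : 'rV[R]_n -> R) (r : R) : (Defs.gnorm h r < +oo)%E <->
  exists K : R, forall x, enorm x <= r -> `|h x| <= K.
Proof.
split=> [|[K hK]]; last first.
  apply: (@lt_trans _ _ (K + 1)%:E); last exact: ltry.
  by apply/gnorm_ltP; exists K => //; rewrite ltrDl.
move=> hy.
have [c /gnorm_ltP[K _ hK]] : exists c : R, (Defs.gnorm h r < c%:E)%E.
  case: (Defs.gnorm h r) hy => [s| |] // _; last by exists 0; exact: ltNyr.
  by exists (s + 1); rewrite lte_fin ltrDl.
by exists K.
Qed.

Lemma locally_boundedP (a : germ R n) : locally_bounded a <->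
  exists f : pfun R n, germ_of f = a /\ exists r K : R,
    0 < r /\ forall x, enorm x <= r -> `|f x| <= K.
Proof.
split=> [[f [r r0 /gnorm_ltyP [K fK]] fa]|[f [fa [r [K [r0 fK]]]]]].
  by exists f; split => //; exists r, K.
by exists f => //; exists r => //; apply/gnorm_ltyP; exists K.
Qed.

Lemma locally_bounded0 : locally_bounded (0 : germ R n).
Proof.
apply/locally_boundedP; exists 0; split; first exact: germ_of0.
exists 1, 0; split => // x _.
by rewrite -(subrr (0 : pfun R n)) pfunB subrr normr0.
Qed.

Lemma locally_boundedB (a b : germ R n) :
  locally_bounded a -> locally_bounded b -> locally_bounded (a - b).
Proof.
move=> /locally_boundedP [f [<- [r [K [r0 fK]]]]].
move=> /locally_boundedP [g [<- [s [L [s0 gL]]]]].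
apply/locally_boundedP; exists (f - g); rewrite germ_ofD germ_ofN; split=> //.
exists (Num.min r s), (K + L); split; first by rewrite lt_min r0.
move=> x; rewrite le_min => /andP[/fK fx /gL gx].
by rewrite pfunB (le_trans (ler_normB _ _))// lerD.
Qed.

Lemma locally_boundedM (a b : germ R n) :
  locally_bounded a -> locally_bounded b -> locally_bounded (germ_mul a b).
Proof.
move=> /locally_boundedP [f [<- [r [K [r0 fK]]]]].
move=> /locally_boundedP [g [<- [s [L [s0 gL]]]]].
apply/locally_boundedP; exists (pfun_mul f g); rewrite germ_ofM; split=> //.
exists (Num.min r s), (K * L); split; first by rewrite lt_min r0.
move=> x; rewrite le_min => /andP[/fK fx /gL gx].
by rewrite /= normrM ler_pM.
Qed.

Lemma pfun_eq (f g : pfun R n) : (forall x, f x = g x) -> f = g.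
Proof. by move=> fg; apply/val_inj/funext. Qed.

Lemma germ_mulA : associative (@germ_mul R n).
Proof.
move=> a b c; have [f <-] := germ_of_surj a; have [g <-] := germ_of_surj b.
have [h <-] := germ_of_surj c; rewrite -!germ_ofM; congr germ_of.
by apply: pfun_eq => x /=; rewrite mulrA.
Qed.

Lemma germ_mulC : commutative (@germ_mul R n).
Proof.
move=> a b; have [f <-] := germ_of_surj a; have [g <-] := germ_of_surj b.
rewrite -!germ_ofM; congr germ_of.
by apply: pfun_eq => x /=; rewrite mulrC.
Qed.

Lemma germ_mulDl : left_distributive (@germ_mul R n) +%R.
Proof.
move=> a b c; have [f <-] := germ_of_surj a; have [g <-] := germ_of_surj b.
have [h <-] := germ_of_surj c.
rewrite -germ_ofD -!germ_ofM -germ_ofD; congr germ_of.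
by apply: pfun_eq => x; rewrite pfunD -[LHS]/((f + g) x * h x) pfunD mulrDl.
Qed.

End locally_bounded_germs.

(** * Separation and continuity of the operations *)

Section topological_ring.
Context (R : realType) (n : nat) (E : nonstandard_extension R).
Context (delta : hyperreal E) (hdelta : positive_infinitesimal delta).
Local Notation T := (tau_germ n delta).
Local Notation D := (trace delta).
Let D_proper : ProperFilter D := trace_proper delta.
#[local] Existing Instance D_proper.

Lemma tube_center (f : pfun R n) m : @moduli R m ->
  tube delta f m (germ_of f).
Proof.
move=> [m0 _ _]; apply/tubeP => //.
apply: filterS (trace_near0 hdelta ltr01) => t /andP[t0 _].
by apply/gnorm_ltP; exists 0; [exact: m0|move=> x _; rewrite subrr normr0].
Qed.

Lemma trace_moduli m (e : R) : @moduli R m -> 0 < e ->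
  \forall t \near D, m t < e.
Proof.
move=> [m0 /cvgrPdist_lt mlim _] e0.
have /nbhs_ballP [d /= d0 dm] := mlim _ e0.
apply: filterS (trace_near0 hdelta d0) => t /andP[t0 td].
have := dm t; rewrite /ball /= !sub0r !normrN (gtr0_norm t0) => /(_ td t0).
by rewrite gtr0_norm// m0.
Qed.

Lemma tau_hausdorff : hausdorff_space T.
Proof.
rewrite open_hausdorff => a b; have [f <-] := germ_of_surj a.
have [g <-] := germ_of_surj b => /eqP fg.
have [|m mm mle] := @moduli_le_gnorm _ _ (f - g).
  by rewrite germ_ofD germ_ofN => /eqP; rewrite subr_eq0 => /eqP.
have mm2 : @moduli R (fun t => 2^-1 * m t) by apply: moduli_scale.
exists (tube delta f (fun t => 2^-1 * m t), tube delta g (fun t => 2^-1 * m t)).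
  by split; apply: mem_set; exact: tube_center.
split; [exact: open_tube|exact: open_tube|].
apply/eqP/seteqP; split=> // c /= []; have [k <-] := germ_of_surj c.
move=> /(tubeP hdelta) kf /(tubeP hdelta) kg.
have [t [[/andP[t0 t1] /gnorm_ltP[c1 c1m kf1]] /gnorm_ltP[c2 c2m kg2]]] :=
  filter_ex (filterI (filterI (trace_near0 hdelta ltr01) kf) kg).
suff : (Defs.gnorm (f - g)%R t < (m t)%:E)%E by rewrite ltNge mle.
apply/gnorm_ltP; exists (c1 + c2); first by lra.
move=> x xt; rewrite pfunB.
rewrite (_ : f x - g x = (k x - g x) - (k x - f x)); last ring.
by rewrite [leRHS]addrC (le_trans (ler_normB _ _))// lerD ?kf1 ?kg2.
Qed.

Lemma tau_add_continuous : continuous (fun p : T * T => p.1 + p.2).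
Proof.
move=> [a b]; have [f <-] := germ_of_surj a; have [g <-] := germ_of_surj b.
suff : p.1 + p.2 @[p --> (germ_of f : T, germ_of g : T)] -->
    (germ_of (f + g) : T).
  by rewrite germ_ofD.
apply: cvg_tube => d m mm /(tubeP hdelta) dm.
have [e eE] : exists e : pfun R n, forall x, e x = f x + g x - d x.
  by exists (f + g - d) => x; rewrite pfunB pfunD.
have em : small delta e m.
  by apply: sub_small dm; apply: filterE => t x _; rewrite eE pfunD.
exists (twin_tube delta f e 2 m, twin_tube delta g e 2 m).
  by split; apply: nbhs_twin_tube.
move=> [c c'] [/= Hc Hc']; have [h hE] := germ_of_surj c.
have [h' hE'] := germ_of_surj c'; rewrite -hE -hE' /= -germ_ofD.
apply/tubeP => //.
apply: filterS2 (Hc _ hE) (Hc' _ hE') => t /gnorm_ltP[c1 c1m hc1].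
move=> /gnorm_ltP[c2 c2m hc2]; apply/gnorm_ltP.
(* 2 |u| + |e| <= c1 and 2 |v| + |e| <= c2 have mean |u| + |v| + |e|. *)
exists (2^-1 * (c1 + c2)).
  by lra.
move=> x xt; have := le_trans (ler_norm _) (hc1 x xt).
have := le_trans (ler_norm _) (hc2 x xt); rewrite !eE.
rewrite pfunD.
rewrite (_ : h x + h' x - d x =
  h x - f x + (h' x - g x) + (f x + g x - d x)); last ring.
have := ler_normD (h x - f x + (h' x - g x)) (f x + g x - d x).
by have := ler_normD (h x - f x) (h' x - g x); lra.
Qed.

Lemma tau_opp_continuous : continuous (fun a : T => - a).
Proof.
move=> a; have [f <-] := germ_of_surj a.
have FN : Filter ((fun c : T => - c) @ nbhs (germ_of f : T)).
  exact: fmap_filter.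
suff : (fun c : T => - c) @ nbhs (germ_of f : T) --> (germ_of (- f) : T).
  by rewrite germ_ofN.
apply: cvg_tube => d m mm /(tubeP hdelta) dm.
have [e eE] : exists e : pfun R n, forall x, e x = - f x - d x.
  by exists (- f - d) => x; rewrite pfunB pfunN.
have em : small delta e m.
  by apply: sub_small dm; apply: filterE => t x _; rewrite eE pfunN.
have fe := nbhs_twin_tube hdelta f ltr01 mm em.
apply: filterS fe => c Hc; have [h hE] := germ_of_surj c.
rewrite /= -hE -germ_ofN; apply/tubeP => //; apply: sub_small (Hc _ hE).
apply: filterE => t x _; rewrite pfunN mul1r eE.
apply: le_trans (ler_norm _).
rewrite (_ : - h x - d x = (- f x - d x) - (h x - f x)); last ring.
by rewrite [leRHS]addrC ler_normB.
Qed.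

(** Boundedness of the two germs absorbs the cross terms [f v] and [u g] into
    the gap; the term [u v] follows because [u] is infinitesimal at [delta]. *)
Lemma tau_mul_continuous (a b : T) : locally_bounded a -> locally_bounded b ->
  {for (a, b), continuous (fun p : T * T => germ_mul p.1 p.2 : T)}.
Proof.
move=> /locally_boundedP [f [<- [r [K [r0 fK]]]]].
move=> /locally_boundedP [g [<- [s [L [s0 gL]]]]].
rewrite /continuous_at /=.
suff : (germ_mul p.1 p.2 : T) @[p --> (germ_of f : T, germ_of g : T)] -->
    (germ_of (pfun_mul f g) : T) by rewrite germ_ofM.
apply: cvg_tube => d m mm /(tubeP hdelta) dm.
have [e eE] : exists e : pfun R n, forall x, e x = f x * g x - d x.
  by exists (pfun_mul f g - d) => x; rewrite pfunB.
have em : small delta e m.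
  by apply: sub_small dm; apply: filterE => t x _; rewrite eE.
pose M := 1 + `|K| + `|L|.
have M1 : 1 <= M by rewrite /M -addrA lerDl addr_ge0.
have KM : K <= M by have := ler_norm K; have := normr_ge0 L; rewrite /M; lra.
have LM : L <= M by have := ler_norm L; have := normr_ge0 K; rewrite /M; lra.
have M3 : 0 < 3 * M by lra.
exists (twin_tube delta f e (3 * M) m, twin_tube delta g e (3 * M) m).
  by split; apply: nbhs_twin_tube.
move=> [c c'] [/= Hc Hc']; have [h hE] := germ_of_surj c.
have [h' hE'] := germ_of_surj c'; rewrite -hE -hE' /= -germ_ofM.
apply/tubeP => //.
have near_small : \forall t \near D, [/\ t < r, t < s & m t < 1].
  apply: filterS3 (trace_near0 hdelta r0) (trace_near0 hdelta s0)
    (trace_moduli mm ltr01) => t.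
  by move=> /andP[_ ?] /andP[_ ?].
apply: filterS3 near_small (Hc _ hE) (Hc' _ hE').
move=> t [tr ts mt1] /gnorm_ltP[c1 c1m hc1].
move=> /gnorm_ltP[c2 c2m hc2].
(* Of M |u| + M |v| + M |v| + |e|, the first term and a third of the last
   make c1 / 3, the rest 2 c2 / 3. *)
apply/gnorm_ltP; exists (c1 / 3 + 2 / 3 * c2); first by lra.
move=> x xt; have := le_trans (ler_norm _) (hc1 x xt).
have := le_trans (ler_norm _) (hc2 x xt); rewrite !eE.
have fM : `|f x| <= M by apply: le_trans KM; apply: fK; lra.
have gM : `|g x| <= M by apply: le_trans LM; apply: gL; lra.
rewrite /= ?eE.
set u := h x - f x; set v := h' x - g x; set w := f x * g x - d x.
have -> : h x * h' x - d x = u * v + f x * v + u * g x + w.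
  by rewrite /u /v /w; ring.
move=> hv hu.
have u0 := normr_ge0 u; have v0 := normr_ge0 v; have e0 := normr_ge0 w.
have uM : `|u| <= M by nra.
have : `|u * v| <= M * `|v| by rewrite normrM ler_wpM2r.
have : `|f x * v| <= M * `|v| by rewrite normrM ler_wpM2r.
have : `|u * g x| <= M * `|u| by rewrite normrM mulrC ler_wpM2r.
have := ler_normD (u * v + f x * v + u * g x) w.
have := ler_normD (u * v + f x * v) (u * g x).
have := ler_normD (u * v) (f x * v).
by lra.
Qed.

End topological_ring.

Theorem proposition4p1 (R : realType) (n : nat) (E : nonstandard_extension R)
    (delta : hyperreal E) (hdelta : positive_infinitesimal delta) :
  hausdorff_space (tau_germ n delta) /\
  @topological_ring_on (tau_germ n delta) (@germ_mul R n) (@locally_bounded R n).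
Proof.
split; first exact: tau_hausdorff.
split.
- exact: germ_mulA.
- exact: germ_mulC.
- exact: germ_mulDl.
- exact: tau_add_continuous.
- exact: tau_opp_continuous.
- exact: locally_bounded0.
- exact: locally_boundedB.
- exact: locally_boundedM.
- exact: tau_mul_continuous.
Qed.
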